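(* Within the pseudovariety $\mathsf M$ of all finite monoids, the pseudoidentity $x^{\omega+1}=x^\omega$ is h-strong.
   Context: $\mathsf M$ is the pseudovariety of finite monoids (signature: multiplication and $1$); $\Omega_A\mathsf M$ is the free profinite monoid on a finite set $A$. In a profinite monoid $x^\omega=\lim x^{n!}$ and $x^{\omega+1}=x^\omega x$. An $\mathsf M$-pseudoidentity is $u=v$ with $u,v\in\Omega_B\mathsf M$, $B$ finite; it holds in a finite monoid $T$ if both sides agree under every continuous homomorphism $\Omega_B\mathsf M\to T$; $[\![\Sigma]\!]$ is the class of finite monoids satisfying $\Sigma$. Provability: for finite $A$, $\Sigma_0\subseteq\Omega_A\mathsf M\times\Omega_A\mathsf M$ is the set of pairs $(\mathbf t(\varphi(u),w_1,\dots,w_n),\mathbf t(\varphi(v),w_1,\dots,w_n))$ with $u=v$ or $v=u$ in $\Sigma$ ($u,v\in\Omega_B\mathsf M$), $\varphi:\Omega_B\mathsf M\to\Omega_A\mathsf M$ a continuous homomorphism, $\mathbf t$ a monoid term, $w_i\in\Omega_A\mathsf M$; $\Sigma_{2\alpha+1}$ is the transitive closure of $\Sigma_{2\alpha}$, $\Sigma_{2\alpha+2}$ the topological closure of $\Sigma_{2\alpha+1}$, unions at limit ordinals; $u=v$ is provable from $\Sigma$ if $(u,v)\in\bigcup_\alpha\Sigma_\alpha$. A set $\Sigma$ (or a single pseudoidentity, viewed as a one-element set) is h-strong within $\mathsf M$ if every $\mathsf M$-pseudoidentity valid in $[\![\Sigma]\!]$ is provable from $\Sigma$. *)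

(* Defs.v *)
From Stdlib Require List.
From mathcomp Require Import all_boot.
Set Implicit Arguments. Unset Strict Implicit. Unset Printing Implicit Defensive.

Record fmon := FMon {
  car :> finType;
  fmul : car -> car -> car;
  fone : car;
  fmulA : forall x y z, fmul x (fmul y z) = fmul (fmul x y) z;
  fmul1x : forall x, fmul fone x = x;
  fmulx1 : forall x, fmul x fone = x }.

Definition is_fhom (T T' : fmon) (h : car T -> car T') : Prop :=
  (forall x y, h (fmul x y) = fmul (h x) (h y)) /\ h (fone T) = fone T'.

(** * The free profinite monoid Omega_A M, realised as the A-ary implicit
    operations on finite monoids (natural families of interpretations). *)
Definition natural (A : finType) (u : forall T : fmon, (A -> car T) -> car T) :=
  forall (T T' : fmon) (h : car T -> car T'), is_fhom h ->
    forall phi : A -> car T, h (u T phi) = u T' (fun a => h (phi a)).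

Definition Omega (A : finType) :=
  { u : forall T : fmon, (A -> car T) -> car T | natural u }.

(** Coordinates of the (product-of-discrete) profinite topology. *)
Definition coord (A : finType) := { T : fmon & A -> car T }.
Definition at_coord (A : finType) (u : Omega A) (c : coord A) : car (projT1 c) :=
  proj1_sig u (projT1 c) (projT2 c).
Definition agree (A : finType) (F : seq (coord A)) (u v : Omega A) : Prop :=
  forall c, List.In c F -> at_coord u c = at_coord v c.

Lemma natural_mul (A : finType) (u v : Omega A) :
  natural (fun T phi => fmul (proj1_sig u T phi) (proj1_sig v T phi)).
Proof.
move=> T T' h [hM h1] phi; rewrite hM.
by rewrite (proj2_sig u _ _ h (conj hM h1)) (proj2_sig v _ _ h (conj hM h1)).
Qed.
Definition omul (A : finType) (u v : Omega A) : Omega A := exist _ _ (natural_mul u v).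

Lemma natural_one (A : finType) : natural (fun (T : fmon) (_ : A -> car T) => fone T).
Proof. by move=> T T' h [_ h1] phi. Qed.
Definition oone (A : finType) : Omega A := exist _ _ (@natural_one A).

Lemma natural_gen (A : finType) (a : A) : natural (fun (T : fmon) (phi : A -> car T) => phi a).
Proof. by []. Qed.
Definition ogen (A : finType) (a : A) : Omega A := exist _ _ (natural_gen a).

Fixpoint opow (A : finType) (u : Omega A) (n : nat) : Omega A :=
  if n is n'.+1 then omul (opow u n') u else oone A.

Definition olim (A : finType) (s : nat -> Omega A) (w : Omega A) : Prop :=
  forall c : coord A, exists N, forall n, N <= n -> at_coord (s n) c = at_coord w c.

Definition is_ohom (B A : finType) (f : Omega B -> Omega A) : Prop :=
  (forall u v, f (omul u v) = omul (f u) (f v)) /\ f (oone B) = oone A.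
Definition ocont (B A : finType) (f : Omega B -> Omega A) : Prop :=
  forall (u : Omega B) (c : coord A), exists F : seq (coord B),
    forall v, agree F u v -> at_coord (f v) c = at_coord (f u) c.
Definition is_ochom (B A : finType) (f : Omega B -> Omega A) : Prop :=
  is_ohom f /\ ocont f.

Definition is_tchom (B : finType) (T : fmon) (f : Omega B -> car T) : Prop :=
  ((forall u v, f (omul u v) = fmul (f u) (f v)) /\ f (oone B) = fone T) /\
  (forall u : Omega B, exists F : seq (coord B), forall v, agree F u v -> f v = f u).

Record pid := Pid { pB : finType; plhs : Omega pB; prhs : Omega pB }.

Definition holds (T : fmon) (p : pid) : Prop :=
  forall f : Omega (pB p) -> car T, is_tchom f -> f (plhs p) = f (prhs p).

Definition models (Sigma : pid -> Prop) (T : fmon) : Prop :=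
  forall p, Sigma p -> holds T p.
Definition valid_in (Sigma : pid -> Prop) (p : pid) : Prop :=
  forall T : fmon, models Sigma T -> holds T p.

Inductive mterm := TVar of nat | TOne | TMul of mterm & mterm.
Fixpoint teval (A : finType) (env : nat -> Omega A) (t : mterm) : Omega A :=
  match t with
  | TVar i => env i
  | TOne => oone A
  | TMul t1 t2 => omul (teval env t1) (teval env t2)
  end.
Definition scons (A : finType) (x : Omega A) (w : nat -> Omega A) (i : nat) :=
  if i is i'.+1 then w i' else x.

(** * Provability: the union over all ordinals of the Sigma_alpha, i.e. the least
    subset of Omega A x Omega A containing Sigma_0 that is closed under
    transitive closure and topological closure. *)
Inductive provable (Sigma : pid -> Prop) (A : finType) : Omega A -> Omega A -> Prop :=
| prov_base : forall (p : pid) (phi : Omega (pB p) -> Omega A) (t : mterm) (w : nat -> Omega A),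
    Sigma p -> is_ochom phi ->
    provable Sigma (teval (scons (phi (plhs p)) w) t) (teval (scons (phi (prhs p)) w) t)
| prov_base_sym : forall (p : pid) (phi : Omega (pB p) -> Omega A) (t : mterm) (w : nat -> Omega A),
    Sigma p -> is_ochom phi ->
    provable Sigma (teval (scons (phi (prhs p)) w) t) (teval (scons (phi (plhs p)) w) t)
| prov_trans : forall u v x, provable Sigma u v -> provable Sigma v x -> provable Sigma u x
| prov_closure : forall u v,
    (forall F : seq (coord A), exists u' v',
        provable Sigma u' v' /\ agree F u u' /\ agree F v v') ->
    provable Sigma u v.

Definition h_strong (Sigma : pid -> Prop) : Prop :=
  forall (A : finType) (u v : Omega A), valid_in Sigma (Pid u v) -> provable Sigma u v.

Definition ox : Omega unit := ogen tt.

(* Main.v *)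
(** Fix a finite quotient S of the free profinite monoid, and call a subset of S
    liftable when its elements have lifts that are all provably equal to one another.
    Liftable sets are closed under products, and the union of the high powers of a
    liftable set Z is liftable: a long product of elements of Z contains a factor g
    that fixes the preceding prefix p (so p = p g^omega), and z^i (z^k)^omega z^r =
    z^omega is provable.  Henckell's theorem on aperiodic pointlikes, which follows by
    induction along local divisors, then yields a finite aperiodic monoid U such that
    words with the same value in U have values in S lying in a common liftable set.
    If u = v holds in all aperiodic monoids, u and v agree in U, hence there are
    provably equal u', v' with the same values in S as u, v; as S is arbitrary, the
    closure rule concludes. *)
Require Import Defs.
From HB Require Import structures.
From mathcomp Require Import all_boot boolp.
Set Implicit Arguments. Unset Strict Implicit. Unset Printing Implicit Defensive.

(* Finite monoids: products, powers and constructions *)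
Local Infix "∘" := fmul (at level 40, left associativity).

HB.instance Definition _ (T : fmon) :=
  Monoid.isLaw.Build T (fone T) (@fmul T) (@fmulA T) (@fmul1x T) (@fmulx1 T).

Definition mprod (T : fmon) (I : Type) (f : I -> T) (s : seq I) : T :=
  \big[@fmul T/fone T]_(i <- s) f i.

Definition fexp (T : fmon) (x : T) (n : nat) : T := iter n (fmul x) (fone T).
Arguments fexp : simpl never.

Section FiniteMonoids.
Variable T : fmon.
Implicit Types x y : T.

Lemma mprod_nil (I : Type) (f : I -> T) : mprod f [::] = fone T.
Proof. exact: big_nil. Qed.

Lemma mprod_cons (I : Type) (f : I -> T) i s : mprod f (i :: s) = f i ∘ mprod f s.
Proof. exact: big_cons. Qed.

Lemma mprod_cat (I : Type) (f : I -> T) s t : mprod f (s ++ t) = mprod f s ∘ mprod f t.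
Proof. exact: big_cat. Qed.

Lemma fexpS x n : fexp x n.+1 = x ∘ fexp x n. Proof. by []. Qed.

Lemma fexp1 x : fexp x 1 = x. Proof. exact: fmulx1. Qed.

Lemma fexpD x m n : fexp x (m + n) = fexp x m ∘ fexp x n.
Proof. by elim: m => [|m IHm]; rewrite ?fmul1x // addSn !fexpS IHm fmulA. Qed.

Lemma fexpSr x n : fexp x n.+1 = fexp x n ∘ x.
Proof. by rewrite -addn1 fexpD fexp1. Qed.

Lemma fexp1n n : fexp (fone T) n = fone T.
Proof. by elim: n => // n IHn; rewrite fexpS IHn fmul1x. Qed.

Lemma fexpM x m n : fexp x (m * n) = fexp (fexp x m) n.
Proof. by elim: n => [|n IHn]; rewrite ?muln0 // mulnS fexpD IHn. Qed.

Lemma fexp_idem x n : x ∘ x = x -> fexp x n.+1 = x.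
Proof. by move=> xx; elim: n => [|n IHn]; rewrite ?fexp1 // fexpS IHn. Qed.

Lemma fexp_absorb x y n : x ∘ y = x -> x ∘ fexp y n = x.
Proof. by move=> xy; elim: n => [|n IHn]; rewrite ?fmulx1 // fexpS fmulA xy. Qed.

End FiniteMonoids.

Lemma pigeonhole (T : finType) (f : nat -> T) :
  exists i j, [/\ i < j, j <= #|T| & f i = f j].
Proof.
have : ~~ injectiveb (fun i : 'I_#|T|.+1 => f i).
  apply/negP => /injectiveP /leq_card; by rewrite card_ord ltnn.
case/injectivePn => i [j ne_ij fij].
case: (ltngtP i j) => [lt_ij | lt_ji | /val_inj eq_ij].
- by exists i, j; split=> //; rewrite -ltnS.
- by exists j, i; split=> //; rewrite -ltnS.
- by rewrite eq_ij eqxx in ne_ij.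
Qed.

Definition aperiodic (T : fmon) := exists n, forall x : T, fexp x n.+1 = fexp x n.

Lemma aperiodic_ge (T : fmon) n (x : T) m :
  fexp x n.+1 = fexp x n -> n <= m -> fexp x m.+1 = fexp x m.
Proof.
move=> xn /subnKC <-; elim: (m - n) => [|k IHk]; first by rewrite addn0.
by rewrite addnS fexpS IHk.
Qed.

Definition trivial_fmon : fmon.
Proof. by apply: (@FMon unit (fun _ _ => tt) tt) => // -[]. Defined.

Definition prod_fmon (S T : fmon) : fmon.
Proof.
apply: (@FMon (S * T)%type (fun x y => (x.1 ∘ y.1, x.2 ∘ y.2)) (fone S, fone T)).
- by move=> x y z; rewrite !fmulA.
- by case=> x y; rewrite !fmul1x.
- by case=> x y; rewrite !fmulx1.
Defined.

Definition power_fmon (S : fmon) : fmon.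
Proof.
apply: (@FMon {set S} (fun X Y => [set x ∘ y | x in X, y in Y]) [set fone S]).
- move=> X Y Z; apply/setP=> s; apply/imset2P/imset2P => [[x t Xx]|[t z]].
    by case/imset2P=> y z Yy Zz -> ->; exists (x ∘ y) z; rewrite ?imset2_f ?fmulA.
  by case/imset2P=> x y Xx Yy -> Zz ->; exists x (y ∘ z); rewrite ?imset2_f ?fmulA.
- by move=> X; rewrite imset2_set1l -[RHS]imset_id; apply: eq_imset => x; rewrite fmul1x.
- by move=> X; rewrite imset2_set1r -[RHS]imset_id; apply: eq_imset => x; rewrite fmulx1.
Defined.

(** * Preordered monoids with bounded powers *)

(** What the pointlike argument uses of liftable sets ordered by inclusion. The preorder stands for
    a quotient monoid, so local divisors are reached without forming quotients. *)
Record bounded_powers (M : fmon) (le : rel M) (Q : M -> Prop) : Prop := BoundedPowers {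
  bp_refl : reflexive le;
  bp_trans : transitive le;
  bp_mul : forall x x' y y', le x y -> le x' y' -> le (x ∘ x') (y ∘ y');
  bp_one : Q (fone M);
  bp_mulQ : forall x y, Q x -> Q y -> Q (x ∘ y);
  bp_pow : forall z, Q z -> exists y N, Q y /\ forall n, N <= n -> le (fexp z n) y }.

Section BoundedPowers.
Variables (M : fmon) (le : rel M) (Q : M -> Prop).
Hypothesis bpM : bounded_powers le Q.

Let eqv x y := le x y && le y x.

(** The measure of the outer induction: the order of the quotient that [le] represents. *)
Definition nclasses := #|[set [set y | le x y && le y x] | x in M]|.

Lemma le_mul2l x y z : le y z -> le (x ∘ y) (x ∘ z).
Proof. exact: (bp_mul bpM) (bp_refl bpM x). Qed.

Lemma le_mul2r x y z : le y z -> le (y ∘ x) (z ∘ x).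
Proof. by move=> yz; apply: (bp_mul bpM yz) (bp_refl bpM x). Qed.

Lemma eqv_trans x y z : eqv x y -> eqv y z -> eqv x z.
Proof.
case/andP=> xy yx /andP[yz zy]; apply/andP; split.
  exact: (bp_trans bpM) xy yz.
exact: (bp_trans bpM) zy yx.
Qed.

Lemma eqv_mul x x' y y' : eqv x y -> eqv x' y' -> eqv (x ∘ x') (y ∘ y').
Proof. by case/andP=> ? ? /andP[? ?]; rewrite /eqv !(bp_mul bpM). Qed.

Lemma eqv_refl x : eqv x x.
Proof. by rewrite /eqv (bp_refl bpM). Qed.

Definition invertible c := exists d, le (c ∘ d) (fone M) && le (fone M) (c ∘ d).

Lemma invertible_mul x y : invertible x -> invertible y -> invertible (x ∘ y).
Proof.
case=> d xd [e ye]; exists (e ∘ d); apply: eqv_trans xd.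
rewrite -fmulA (fmulA y); apply: eqv_mul (eqv_refl x) _.
by rewrite -[X in eqv _ X](fmul1x d); apply: eqv_mul ye (eqv_refl d).
Qed.

(** Two powers c^i = c^j with i < j coincide; since c^i d^i is equivalent to 1, multiplying by d^i
    on the right leaves c^(j-i) equivalent to 1. *)
Lemma invertible_exp c : invertible c -> exists2 p, 0 < p & eqv (fexp c p) (fone M).
Proof.
case=> d cd.
have cdn n : eqv (fexp c n ∘ fexp d n) (fone M).
  elim: n => [|n IHn]; first by rewrite fmul1x eqv_refl.
  rewrite fexpSr fexpS -fmulA (fmulA c); apply: eqv_trans IHn.
  apply: eqv_mul (eqv_refl _) _; rewrite -[X in eqv _ X]fmul1x.
  exact: eqv_mul cd (eqv_refl _).
have [i [j [lt_ij _ cij]]] := pigeonhole (fexp c).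
exists (j - i); rewrite ?subn_gt0 //.
apply: eqv_trans (cdn i).
have -> : fexp c i = fexp c (j - i) ∘ fexp c i by rewrite -fexpD subnK // ltnW.
rewrite -fmulA -[X in eqv X _]fmulx1; apply: eqv_mul (eqv_refl _) _.
by rewrite /eqv andbC; apply: cdn.
Qed.

(** If a^p is equivalent to 1, arbitrarily high powers of a lie above 1, and the next ones above a;
    a bound of all high powers lies above both. *)
Lemma invertible_bound a : Q a -> invertible a ->
  exists y, [/\ Q y, le (fone M) y & le a y].
Proof.
move=> Qa /invertible_exp[p p_gt0 /andP[ap1 ap2]].
have [y [N [Qy leN]]] := bp_pow bpM Qa; exists y.
have le1 k : le (fone M) (fexp a (p * k)).
  elim: k => [|k IHk]; first by rewrite muln0 (bp_refl bpM).
  by rewrite mulnS fexpD -(fmul1x (fone M)) (bp_mul bpM).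
have leNp : N <= p * N by rewrite leq_pmull.
split=> //; first exact: (bp_trans bpM) (le1 N) (leN _ leNp).
apply: (bp_trans bpM) (leN (p * N).+1 (leqW leNp)).
by rewrite fexpS -[X in le X _]fmulx1; apply: le_mul2l.
Qed.

Lemma invertible_common_bound (s : seq M) :
  exists y, [/\ Q y, le (fone M) y &
    forall a, a \in s -> Q a -> invertible a -> le a y].
Proof.
elim: s => [|a s [y [Qy le1y ley]]].
  by exists (fone M); split; rewrite ?(bp_refl bpM) //; apply: (bp_one bpM).
have [[Qa ua]|nQa] := pselect (Q a /\ invertible a); last first.
  exists y; split=> // b; rewrite inE => /predU1P[-> Qa ua|]; last exact: ley.
  by case: nQa.
have [z [Qz le1z leaz]] := invertible_bound Qa ua.
exists (y ∘ z); split; first exact: (bp_mulQ bpM).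
  by rewrite -(fmul1x (fone M)) (bp_mul bpM).
move=> b; rewrite inE => /predU1P[-> _ _|bs Qb ub].
  by rewrite -[a]fmul1x (bp_mul bpM).
by rewrite -[b]fmulx1 (bp_mul bpM) ?ley.
Qed.

(** ** Local divisors *)

Section LocalDivisor.
Variable c : M.

(* [Some a] stands for [c a c] and [None] for [c]: the local divisor of [M] at [c]
   is the quotient of this monoid under [local_val], realised through the preorder. *)
Definition local_mul (x y : option M) : option M :=
  match x, y with
  | Some a, Some b => Some (a ∘ c ∘ b)
  | Some a, None => Some a
  | None, _ => y
  end.

Definition local_fmon : fmon.
Proof.
apply: (@FMon (option M) local_mul None) => [||[]//]; last by [].
by move=> [x|] [y|] [z|] //=; rewrite !fmulA.
Defined.

Definition local_val (x : option M) : M := if x is Some a then c ∘ a ∘ c else c.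

Definition local_le (x y : local_fmon) := le (local_val x) (local_val y).

(** The condition is on a, not on c a c: together with Q c it gives Q (a c), and the powers of a c
    govern those of [Some a]. *)
Definition local_Q (x : local_fmon) : Prop := if x is Some a then Q a else True.

(** The value of a product is a translate of the value of one factor; this makes [local_le]
    compatible with multiplication. *)
Lemma local_valM (x y : local_fmon) :
  local_val (x ∘ y) = local_val x ∘ (if y is Some b then b ∘ c else fone M).
Proof. by case: x y => [a|] [b|] //=; rewrite ?fmulx1 ?fmulA. Qed.

Lemma local_valM' (x y : local_fmon) :
  local_val (x ∘ y) = (if x is Some b then c ∘ b else fone M) ∘ local_val y.
Proof. by case: x y => [a|] [b|] //=; rewrite ?fmul1x ?fmulA. Qed.

Lemma local_bounded_powers : Q c -> bounded_powers local_le local_Q.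
Proof.
move=> Qc; split=> //.
- by move=> x; apply: (bp_refl bpM).
- by move=> y x z; apply: (bp_trans bpM).
- move=> x x' y y' xy xy'; apply: (bp_trans bpM) (_ : le (local_val ((y : local_fmon) ∘ x')) _).
    by rewrite !local_valM; apply: le_mul2r.
  by rewrite !local_valM'; apply: le_mul2l.
- by move=> [a|] [b|] //= Qa Qb; do !apply: (bp_mulQ bpM).
move=> [a|] Qa; last first.
  exists None, 0; split=> // n _.
  by rewrite [fexp _ n](fexp1n local_fmon) /local_le (bp_refl bpM).
have [y [N [Qy leN]]] := bp_pow bpM (bp_mulQ bpM Qa Qc).
exists (Some (y ∘ a)), N.+1; split=> [|[//|n] leNn]; first exact: (bp_mulQ bpM).
have -> : fexp (Some a : local_fmon) n.+1 = Some (fexp (a ∘ c) n ∘ a).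
  elim: n {leNn} => [|n IHn]; first by rewrite fexp1 fmul1x.
  by rewrite fexpS IHn /= fexpS !fmulA.
rewrite /local_le /= !fmulA; do 2!apply: le_mul2r; apply: le_mul2l; exact: leN.
Qed.

End LocalDivisor.
End BoundedPowers.

(** Classes of the local divisor are preimages of classes of M. The class of 1 is missed: every
    value begins with c, and c x equivalent to 1 would make c invertible. *)
Lemma nclasses_local (M : fmon) (le : rel M) (Q : M -> Prop) (c : M) :
  bounded_powers le Q -> Q c -> ~ invertible le c ->
  nclasses (local_le le (c := c)) < nclasses le.
Proof.
move=> bpM Qc nuc; rewrite /nclasses.
pose cls (x : M) := [set y | le x y && le y x].
pose lcls (x : local_fmon c) := [set y | local_le le x y && local_le le y x].
pose g (X : {set M}) : {set local_fmon c} := [set x | local_val c x \in X].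
have lclsE x : lcls x = g (cls (local_val c x)).
  by apply/setP=> y; rewrite !inE.
pose D := [set cls x | x in M] :\ cls (fone M).
have : [set lcls x | x in local_fmon c] \subset g @: D.
  apply/subsetP=> _ /imsetP[x _ ->]; rewrite lclsE; apply: imset_f.
  rewrite !inE imset_f // andbT; apply/eqP => eq1; apply: nuc.
  have: fone M \in cls (local_val c x) by rewrite eq1 inE (bp_refl bpM).
  rewrite inE => /andP[]; case: x {eq1} => [a|] /= le1 le2.
    by exists (a ∘ c); rewrite fmulA le1.
  by exists (fone M); rewrite fmulx1 le1.
move/subset_leq_card/leq_ltn_trans; apply; apply: leq_ltn_trans (leq_imset_card _ _) _.
rewrite [X in _ < X](cardsD1 (cls (fone M))) imset_f //= add1n.
Qed.

(** * Aperiodic pointlikes *)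

Section Gluing.
Variables (U V : fmon) (f : U -> V).

(* Values of words [u_0 b u_1 b ... b u_n]: [inl] when [b] does not occur, otherwise
   the values of [u_0] and [u_n] together with [f(u_1) ... f(u_(n-1))]. *)
Definition glue_mul (x y : U + U * V * U) : U + U * V * U :=
  match x, y with
  | inl u, inl u' => inl (u ∘ u')
  | inl u, inr (p, m, q) => inr (u ∘ p, m, q)
  | inr (p, m, q), inl u => inr (p, m, q ∘ u)
  | inr (p, m, q), inr (p', m', q') => inr (p, m ∘ f (q ∘ p') ∘ m', q')
  end.

Definition glue_fmon : fmon.
Proof.
apply: (@FMon (U + U * V * U)%type glue_mul (inl (fone U))).
- by move=> [x|[[? ?] ?]] [y|[[? ?] ?]] [z|[[? ?] ?]] //=; rewrite !fmulA.
- by move=> [x|[[? ?] ?]] /=; rewrite fmul1x.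
- by move=> [x|[[? ?] ?]] /=; rewrite fmulx1.
Defined.

(** The power n+1 of (p, m, q) has middle (m f(q p))^n m, so V controls it; the lag of one explains
    the successor in the bound. *)
Lemma glue_aperiodic : aperiodic U -> aperiodic V -> aperiodic glue_fmon.
Proof.
case=> n1 apU [n2 apV]; exists (maxn n1 n2).+1 => -[u|[[p m] q]].
  have E n : fexp (inl u : glue_fmon) n = inl (fexp u n).
    by elim: n => // n IHn; rewrite fexpS IHn.
  by rewrite !E (aperiodic_ge (apU u)) // leqW // leq_maxl.
have E n : fexp (inr (p, m, q) : glue_fmon) n.+1
         = inr (p, fexp (m ∘ f (q ∘ p)) n ∘ m, q).
  elim: n => [|n IHn]; first by rewrite fexp1 fmul1x.
  by rewrite fexpS IHn /= !fmulA.
by rewrite !E (aperiodic_ge (apV _)) // leq_maxr.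
Qed.

End Gluing.

(** Words over D with the same value in an aperiodic U have values below a common element of Q.
    Keeping D apart from B allows induction on the number of letters. *)
Definition aperiodic_cover (M : fmon) (le : rel M) (Q : M -> Prop)
    (B : finType) (beta : B -> M) (D : {set B}) :=
  exists (U : fmon) (psi : B -> U) (Z : U -> M), [/\ aperiodic U, forall t, Q (Z t) &
    forall s : seq B, {subset s <= D} -> le (mprod beta s) (Z (mprod psi s))].

Section Cover.
Variables (M : fmon) (le : rel M) (Q : M -> Prop).
Hypothesis bpM : bounded_powers le Q.
Variables (B : finType) (beta : B -> M) (D : {set B}).
Hypothesis Qbeta : forall b, Q (beta b).

Lemma invertible_cover :
  {in D, forall b, invertible le (beta b)} -> aperiodic_cover le Q beta D.
Proof.
move=> uD; have [y [Qy le1y ley]] := invertible_common_bound bpM (enum M).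
exists trivial_fmon, (fun _ => tt), (fun _ => y); split=> //; first by exists 0.
move=> s sD; have : Q (mprod beta s) /\ invertible le (mprod beta s).
  elim: s sD => [|b s IHs] sD.
    rewrite mprod_nil; split; first exact: (bp_one bpM).
    by exists (fone M); rewrite fmulx1 (bp_refl bpM).
  have [|Qs us] := IHs; first by move=> x xs; rewrite sD // inE xs orbT.
  rewrite mprod_cons; split; first exact: (bp_mulQ bpM).
  by apply: (invertible_mul bpM) us; apply/uD/sD/mem_head.
by case; apply: ley; rewrite mem_enum.
Qed.

Variable b : B.
Let c := beta b.

(** Words are cut at b as u_0 b u_1 ... b u_n. The u_i are covered by U, and the middle b u_1 ... b
    is the value of a product in the local divisor at c, covered by V. *)
Lemma cover_step : b \in D -> aperiodic_cover le Q beta (D :\ b) ->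
  (forall (B' : finType) (beta' : B' -> local_fmon c),
      (forall x, local_Q Q (beta' x)) ->
      aperiodic_cover (local_le le (c := c)) (local_Q Q (c := c)) beta' setT) ->
  aperiodic_cover le Q beta D.
Proof.
move=> bD [U [psi [Z [apU QZ leZ]]]] coverL.
(* The alphabet of the second cover is U: the letter t stands for [Z t], a bound for the words over
   [D :\ b] of value t. *)
have [V [chi [Y [apV QY leY]]]] := coverL U (fun t => Some (Z t)) QZ.
pose W := glue_fmon chi.
pose psiW (a : B) : W := if a == b then inr (fone U, fone V, fone U) else inl (psi a).
pose R (t : W) : M :=
  match t with
  | inl u => Z u
  | inr (p, m, q) => Z p ∘ local_val c (Y m) ∘ Z q
  end.
exists W, psiW, R; split; first exact: glue_aperiodic.
  case=> [u|[[p m] q]] //=; apply: (bp_mulQ bpM) => //; apply: (bp_mulQ bpM) => //.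
  move: (QY m); case: (Y m) => [a|] /= Qa; last exact: Qbeta.
  exact: (bp_mulQ bpM (bp_mulQ bpM (Qbeta b) Qa) (Qbeta b)).
(* [mid us] is the value of the word [b u_1 b u_2 ... b]. *)
pose mid := foldr (fun u x => c ∘ mprod beta u ∘ x) c.
pose ok (u : seq B) := {subset u <= D :\ b}.
have le_mid us : (forall u, u \in us -> ok u) ->
    le (mid us) (local_val c (Y (mprod chi (map (mprod psi) us)))).
  move=> us_ok.
  apply: (bp_trans bpM) (leY (map (mprod psi) us) (fun x _ => in_setT x)).
  elim: us us_ok => [|u us IHus] us_ok.
    by rewrite mprod_nil (bp_refl bpM).
  rewrite /= mprod_cons local_valM'; apply: (bp_mul bpM).
    by apply: (le_mul2l bpM); apply: leZ; apply: us_ok; rewrite mem_head.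
  by apply: IHus => v vs; apply: us_ok; rewrite inE vs orbT.
move=> s sD.
have [[s_ok ->]|[u0 [us [un [u0_ok us_ok un_ok -> ->]]]]] :
    (ok s /\ mprod psiW s = inl (mprod psi s)) \/
    exists u0 us un, [/\ ok u0, forall u, u \in us -> ok u, ok un,
      mprod psiW s = inr (mprod psi u0, mprod chi (map (mprod psi) us), mprod psi un) &
      mprod beta s = mprod beta u0 ∘ mid us ∘ mprod beta un]; last first.
- by do !apply: (bp_mul bpM); rewrite ?leZ ?le_mid.
- exact: leZ.
have ok_nil : ok [::] by [].
elim: s sD => [|a s IHs] sD; first by left; rewrite !mprod_nil.
have {IHs}IH := IHs (fun x xs => sD x (mem_behead (s := a :: s) xs)).
have aD : a \in D by rewrite sD // mem_head.
rewrite !mprod_cons /psiW; case: eqP => [->|/eqP nab].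
- right; case: IH => [[s_ok Es]|[u0 [us [un [u0_ok us_ok un_ok Es Eb]]]]].
  + exists [::], [::], s; split; rewrite ?mprod_nil ?fmul1x //.
    by rewrite -/psiW Es /= !fmul1x.
  + exists [::], (u0 :: us), un; split=> //.
    * by move=> u; rewrite inE => /predU1P[->|/us_ok].
    * by rewrite -/psiW Es /= !mprod_nil mprod_cons !fmul1x.
    * by rewrite Eb mprod_nil fmul1x /= !fmulA.
- have ok_cons u : ok u -> ok (a :: u).
    by move=> u_ok x; rewrite inE => /predU1P[->|/u_ok //]; rewrite !inE nab.
  case: IH => [[s_ok Es]|[u0 [us [un [u0_ok us_ok un_ok Es Eb]]]]].
  + left; split; first exact: ok_cons.
    by rewrite -/psiW Es.
  + right; exists (a :: u0), us, un; split=> //; first exact: ok_cons.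
      by rewrite -/psiW Es mprod_cons.
    by rewrite Eb mprod_cons !fmulA.
Qed.

End Cover.

(** Outer induction on the number of classes, inner one on the number of letters: removing a
    non-invertible letter decreases the latter, passing to its local divisor the former. *)
Lemma aperiodic_coverP (M : fmon) (le : rel M) (Q : M -> Prop) (B : finType)
    (beta : B -> M) (D : {set B}) :
  bounded_powers le Q -> (forall b, Q (beta b)) -> aperiodic_cover le Q beta D.
Proof.
have [n] := ubnP (nclasses le).
elim: n M le Q B beta D => // n IHn M le Q B beta D lt_n bpM Qbeta.
have [m] := ubnP #|D|; elim: m D => // m IHm D lt_m.
have [uD|] := pselect {in D, forall b, invertible le (beta b)}.
  exact: invertible_cover.
move=> /existsNP[b] /not_implyP[bD nub].
apply: (cover_step bpM Qbeta bD) => [|B' beta' Qbeta'].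
  by apply: IHm; rewrite (cardsD1 b) bD in lt_m.
apply: IHn => //; last exact: local_bounded_powers.
exact: leq_trans (nclasses_local bpM (Qbeta b) nub) lt_n.
Qed.

(** * Liftable sets *)

Definition coord_of (A : finType) (T : fmon) (phi : A -> T) : coord A :=
  existT (fun T : fmon => A -> T) T phi.

(** * Implicit operations: substitution, words and finite approximation *)

Section Omega.
Variable A : finType.
Implicit Types u v : Omega A.

Lemma Omega_eq u v : proj1_sig u = proj1_sig v -> u = v.
Proof.
case: u v => [u u_nat] [v v_nat] /= eq_uv.
by move: u_nat v_nat; rewrite eq_uv => p q; rewrite (Prop_irrelevance p q).
Qed.

Lemma at_coord_omul u v c : at_coord (omul u v) c = at_coord u c ∘ at_coord v c.
Proof. by []. Qed.

Lemma at_coord_opow u n c : at_coord (opow u n) c = fexp (at_coord u c) n.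
Proof. by elim: n => // n IHn; rewrite fexpSr -IHn. Qed.

Lemma natural_osubst (w : Omega unit) u :
  natural (fun (T : fmon) (phi : A -> T) => proj1_sig w T (fun=> proj1_sig u T phi)).
Proof.
by move=> T T' h hh phi; rewrite (proj2_sig w _ _ h hh) (proj2_sig u _ _ h hh).
Qed.
(** The image of w under the continuous homomorphism sending the generator to u; it is u^omega when
    w = x^omega. *)
Definition osubst w u : Omega A := exist _ _ (natural_osubst w u).

Lemma osubst_ochom u : is_ochom (osubst^~ u).
Proof.
split; first by split=> *; apply: Omega_eq.
move=> w c; exists [:: coord_of (T := projT1 c) (fun=> at_coord u c)] => w' agr.
exact: (esym (agr _ (or_introl erefl))).
Qed.

Lemma at_coord_tchom (c : coord A) : is_tchom (fun u => at_coord u c).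
Proof.
split=> // u; exists [:: c] => v agr; by rewrite (agr c) //; left.
Qed.

Lemma agree_omul F u u' v v' :
  agree F u u' -> agree F v v' -> agree F (omul u v) (omul u' v').
Proof. by move=> uu' vv' c Fc; rewrite !at_coord_omul uu' ?vv'. Qed.

Lemma olim_agree (s : nat -> Omega A) u (F : seq (coord A)) :
  olim s u -> exists N, forall n, N <= n -> agree F u (s n).
Proof.
move=> lim_s; elim: F => [|c F [N1 agrF]]; first by exists 0 => n _ c [].
have [N2 eq_c] := lim_s c; exists (maxn N1 N2) => n.
by rewrite geq_max => /andP[le1 le2] c' [<-|]; [rewrite eq_c | apply: agrF].
Qed.

(* The values reached by words form a submonoid, and naturality applies to its
   inclusion. *)
Lemma at_coord_word (T : fmon) (phi : A -> T) u :
  exists s : seq A, proj1_sig u T phi = mprod phi s.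
Proof.
pose R := [set t : T | `[< exists s : seq A, t = mprod phi s >]].
have R1 : fone T \in R by rewrite inE; apply/asboolP; exists [::]; rewrite mprod_nil.
have RM (x y : {t : T | t \in R}) : val x ∘ val y \in R.
  move: (valP x) (valP y); rewrite !inE => /asboolP[s ->] /asboolP[t ->].
  by apply/asboolP; exists (s ++ t); rewrite mprod_cat.
have Rgen a : phi a \in R.
  by rewrite inE; apply/asboolP; exists [:: a]; rewrite mprod_cons mprod_nil fmulx1.
pose mulR (x y : {t : T | t \in R}) : {t : T | t \in R} := Sub (val x ∘ val y) (RM x y).
have mulRA : associative mulR.
  by move=> x y z; apply: val_inj; rewrite /= fmulA.
have mul1R : left_id (Sub (fone T) R1) mulR by move=> x; apply: val_inj; rewrite /= fmul1x.
have mulR1 : right_id (Sub (fone T) R1) mulR by move=> x; apply: val_inj; rewrite /= fmulx1.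
pose TR : fmon := FMon mulRA mul1R mulR1.
pose h (x : TR) : T := val x.
have hh : is_fhom h by [].
have := proj2_sig u TR T h hh (fun a => Sub (phi a) (Rgen a) : TR).
rewrite /h /= => <-.
set x := proj1_sig u _ _; have := valP x; rewrite inE => /asboolP[s Es].
by exists s.
Qed.

(** The product of the finitely many monoids determines every coordinate, by naturality along the
    projections. *)
Lemma agree_single_coord (F : seq (coord A)) :
  exists c : coord A, forall u v, at_coord u c = at_coord v c -> agree F u v.
Proof.
elim: F => [|[T phi] F [[S chi] agrF]].
  by exists (coord_of (T := trivial_fmon) (fun=> tt)) => u v _ c [].
exists (coord_of (T := prod_fmon T S) (fun a => (phi a, chi a))) => u v.
have fstE (z : Omega A) : (proj1_sig z (prod_fmon T S) (fun a => (phi a, chi a))).1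
    = proj1_sig z T phi :> T.
  exact: (proj2_sig z (prod_fmon T S) T fst (conj (fun _ _ => erefl) erefl)).
have sndE (z : Omega A) : (proj1_sig z (prod_fmon T S) (fun a => (phi a, chi a))).2
    = proj1_sig z S chi :> S.
  exact: (proj2_sig z (prod_fmon T S) S snd (conj (fun _ _ => erefl) erefl)).
rewrite /at_coord /= => eq_uv c [<-|]; first by rewrite /at_coord /= -!fstE eq_uv.
by apply: agrF; rewrite /at_coord /= -!sndE eq_uv.
Qed.

End Omega.

(** * The deduction calculus: provability is a closed congruence *)

Section Provable.
Variables (Sigma : pid -> Prop) (A : finType).
Local Notation prov := (@provable Sigma A).

Hypothesis Sigma_inhabited : exists p, Sigma p /\
  exists phi : Omega (pB p) -> Omega A, is_ochom phi.

(* The generated induction principle has no hypothesis for the closure rule, in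
   which [provable] occurs under an existential quantifier. *)
Lemma provable_closure_ind (P : Omega A -> Omega A -> Prop) :
  (forall p (phi : Omega (pB p) -> Omega A) t w, Sigma p -> is_ochom phi ->
    P (teval (scons (phi (plhs p)) w) t) (teval (scons (phi (prhs p)) w) t)) ->
  (forall p (phi : Omega (pB p) -> Omega A) t w, Sigma p -> is_ochom phi ->
    P (teval (scons (phi (prhs p)) w) t) (teval (scons (phi (plhs p)) w) t)) ->
  (forall u v x, P u v -> P v x -> P u x) ->
  (forall u v, (forall F, exists u' v', P u' v' /\ agree F u u' /\ agree F v v') ->
    P u v) ->
  forall u v, prov u v -> P u v.
Proof.
move=> Pbase Psym Ptrans Pclos; fix IH 3 => u v [].
- by move=> p phi t w; apply: Pbase.
- by move=> p phi t w; apply: Psym.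
- by move=> {}u {}v x uv vx; apply: Ptrans (IH _ _ uv) (IH _ _ vx).
- move=> {}u {}v closed; apply: Pclos => F.
  case: (closed F) => u' [v' [u'v' agr]]; exists u', v'; split=> //; exact: IH.
Qed.

(** The base rule for a term that avoids variable 0 has equal sides. *)
Lemma provable_refl u : prov u u.
Proof.
have [p [Sp [phi hphi]]] := Sigma_inhabited.
exact: (prov_base (TVar 1) (fun=> u) Sp hphi).
Qed.

Lemma provable_sym u v : prov u v -> prov v u.
Proof.
elim/provable_closure_ind=> {u v}
  [p phi t w Sp hphi|p phi t w Sp hphi|u v x vu xv|u v IH].
- exact: prov_base_sym.
- exact: prov_base.
- exact: prov_trans xv vu.
- by apply: prov_closure => F; have [u' [v' [? [? ?]]]] := IH F; exists v', u'.
Qed.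

Lemma provable_ext u v : (forall c, at_coord u c = at_coord v c) -> prov u v.
Proof.
move=> uv; apply: prov_closure => F; exists u, u.
by split; [exact: provable_refl | split=> c _].
Qed.

(* Translations act on terms by adjoining one new variable. *)
Fixpoint tshift (t : mterm) : mterm :=
  match t with
  | TVar 0 => TVar 0
  | TVar i.+1 => TVar i.+2
  | TOne => TOne
  | TMul t1 t2 => TMul (tshift t1) (tshift t2)
  end.

Lemma teval_tshift (x y : Omega A) w t :
  teval (scons x (scons y w)) (tshift t) = teval (scons x w) t.
Proof. by elim: t => [[]||t1 /= -> t2 ->]. Qed.

(** The factor y is absorbed into the term of the base rules and passes through the closure rule by
    continuity of multiplication. *)
Lemma provable_mul2l y u v : prov u v -> prov (omul y u) (omul y v).
Proof.
elim/provable_closure_ind=> {u v}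
  [p phi t w Sp hphi|p phi t w Sp hphi|u v x uv vx|u v IH].
- have := prov_base (TMul (TVar 1) (tshift t)) (scons y w) Sp hphi.
  by rewrite /= !teval_tshift.
- have := prov_base_sym (TMul (TVar 1) (tshift t)) (scons y w) Sp hphi.
  by rewrite /= !teval_tshift.
- exact: prov_trans uv vx.
- apply: prov_closure => F; have [u' [v' [yuv [uu' vv']]]] := IH F.
  by exists (omul y u'), (omul y v'); split=> //; split; apply: agree_omul.
Qed.

Lemma provable_mul2r y u v : prov u v -> prov (omul u y) (omul v y).
Proof.
elim/provable_closure_ind=> {u v}
  [p phi t w Sp hphi|p phi t w Sp hphi|u v x uv vx|u v IH].
- have := prov_base (TMul (tshift t) (TVar 1)) (scons y w) Sp hphi.
  by rewrite /= !teval_tshift.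
- have := prov_base_sym (TMul (tshift t) (TVar 1)) (scons y w) Sp hphi.
  by rewrite /= !teval_tshift.
- exact: prov_trans uv vx.
- apply: prov_closure => F; have [u' [v' [yuv [uu' vv']]]] := IH F.
  by exists (omul u' y), (omul v' y); split=> //; split; apply: agree_omul.
Qed.

Lemma provable_mul u u' v v' : prov u v -> prov u' v' -> prov (omul u u') (omul v v').
Proof.
move=> uv uv'; apply: prov_trans (provable_mul2r _ uv) (provable_mul2l _ uv').
Qed.

Lemma provable_opow u v n : prov u v -> prov (opow u n) (opow v n).
Proof.
by move=> uv; elim: n => [|n IHn]; [exact: provable_refl | exact: provable_mul].
Qed.

End Provable.

(** * The omega-power and its deductions *)

Section OmegaPower.
Variable w : Omega unit.
Hypothesis w_lim : olim (fun n => opow ox n`!) w.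

Section Value.
Variables (T : fmon) (x : T).

Let xw : T := proj1_sig w T (fun=> x).

Lemma omega_valE : exists N, forall n, N <= n -> fexp x n`! = xw.
Proof.
have [N eqN] := w_lim (coord_of (T := T) (fun=> x)).
by exists N => n /eqN; rewrite at_coord_opow.
Qed.

(** For large n, the power n+1 of x^(n!) is x^((n+1)!), so [xw] equals its power n+1; two
    consecutive n give idempotence. *)
Lemma omega_val_idem : xw ∘ xw = xw.
Proof.
have [N eqN] := omega_valE.
have E n : N <= n -> fexp xw n.+1 = xw.
  by move=> leNn; rewrite -{1}(eqN n leNn) -fexpM mulnC -factS eqN // leqW.
by rewrite -{2}(E N (leqnn N)) -fexpS E // leqW.
Qed.

Lemma omega_val_comm n : xw ∘ fexp x n = fexp x n ∘ xw.
Proof. by have [N /(_ N (leqnn N)) <-] := omega_valE; rewrite -!fexpD addnC. Qed.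

Lemma omega_val_absorb y : y ∘ x = y -> y ∘ xw = y.
Proof. by have [N /(_ N (leqnn N)) <-] := omega_valE; apply: fexp_absorb. Qed.

End Value.

Lemma omega_val_exp (T : fmon) (x : T) k : 0 < k ->
  proj1_sig w T (fun=> fexp x k) = proj1_sig w T (fun=> x).
Proof.
case: k => // k _.
have [N1 E1] := omega_valE x; have [N2 E2] := omega_valE (fexp x k.+1).
rewrite -(E2 (maxn N1 N2)) ?leq_maxr // -fexpM mulnC fexpM E1 ?leq_maxl //.
exact/fexp_idem/omega_val_idem.
Qed.

Lemma aperiodic_models (T : fmon) :
  aperiodic T -> models (fun p => p = Pid (omul w ox) w) T.
Proof.
case=> n0 apT _ -> f [[fM f1] f_cont] /=; rewrite fM.
have [F agrF] := f_cont w; have [N agrN] := olim_agree F w_lim.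
have fX n : f (opow ox n) = fexp (f ox) n.
  by elim: n => // n IHn; rewrite /= fM IHn -fexpSr.
rewrite -(agrF _ (agrN (maxn N n0) (leq_maxl _ _))) fX -fexpSr.
by rewrite (aperiodic_ge (apT _)) // (leq_trans (leq_maxr N n0)) // fact_geq.
Qed.

Variable A : finType.
Local Notation Sigma := (fun p => p = Pid (omul w ox) w).
Local Notation prov := (@provable Sigma A).

Let Sigma_inhabited : exists p, Sigma p /\
  exists phi : Omega (pB p) -> Omega A, is_ochom phi.
Proof.
by exists (Pid (omul w ox) w); split=> //; exists (fun x => osubst x (oone A)); apply: osubst_ochom.
Qed.

Let prefl := provable_refl Sigma_inhabited.
Let pext := provable_ext Sigma_inhabited.

(** The closure rule applies to the approximations u^(n!) and v^(n!). *)
Lemma provable_osubst u v : prov u v -> prov (osubst w u) (osubst w v).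
Proof.
move=> uv; apply: prov_closure => F.
have lim (u' : Omega A) : olim (fun n => opow u' n`!) (osubst w u').
  move=> c; have [N eqN] := omega_valE (at_coord u' c).
  by exists N => n /eqN; rewrite at_coord_opow.
have [N1 agr1] := olim_agree F (lim u); have [N2 agr2] := olim_agree F (lim v).
pose n := maxn N1 N2; exists (opow u n`!), (opow v n`!); split.
  exact: provable_opow.
by split; [apply: agr1; apply: leq_maxl | apply: agr2; apply: leq_maxr].
Qed.

Lemma provable_omega_opow z n : prov (omul (osubst w z) (opow z n)) (osubst w z).
Proof.
elim: n => [|n IHn]; first by apply: pext => c; rewrite at_coord_omul fmulx1.
have base := @prov_base Sigma A (Pid (omul w ox) w) (fun x => osubst x z)
  (TVar 0) (fun=> oone A) erefl (osubst_ochom z).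
apply: prov_trans IHn; apply: prov_trans (_ : prov (omul (omul (osubst w z) z) (opow z n)) _).
  by apply: pext => c; rewrite !at_coord_omul !at_coord_opow -fmulA -fexpS fexpSr.
apply: provable_mul2r; apply: prov_trans base.
by apply: pext.
Qed.

(** In every finite monoid the left side equals z^omega z^(i+r); the pseudoidentity then absorbs
    z^(i+r). *)
Lemma provable_omega_absorb z i k r : 0 < k ->
  prov (omul (omul (opow z i) (osubst w (opow z k))) (opow z r)) (osubst w z).
Proof.
move=> k_gt0; apply: prov_trans (provable_omega_opow z (i + r)); apply: pext => c.
rewrite !at_coord_omul !at_coord_opow fexpD fmulA.
have -> : at_coord (osubst w (opow z k)) c = at_coord (osubst w z) c.
  by apply: etrans (omega_val_exp (at_coord z c) k_gt0); rewrite -at_coord_opow.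
by rewrite (omega_val_comm (at_coord z c) i).
Qed.

(** * Liftable subsets of a finite monoid *)

Variables (S : fmon) (phi : A -> S).

Let val_at (u : Omega A) : S := at_coord u (coord_of phi).

Definition liftable (Z : power_fmon S) : Prop :=
  exists e, forall s, s \in Z -> exists u, val_at u = s /\ prov u e.

(** The lift is provably a power of e that depends only on the length of the product. *)
Lemma liftable_seq (Z : {set S}) e (s : seq S) :
  (forall x, x \in Z -> exists u, val_at u = x /\ prov u e) -> {subset s <= Z} ->
  exists u, val_at u = mprod id s /\ prov u (opow e (size s)).
Proof.
move=> lift_Z; elim/last_ind: s => [|s x IHs] sZ.
  by exists (oone A); rewrite mprod_nil; split; last exact: prefl.
have [|u [Eu ue]] := IHs; first by move=> y ys; rewrite sZ // mem_rcons inE ys orbT.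
have [|v [Ev ve]] := lift_Z x; first by rewrite sZ // mem_rcons mem_head.
exists (omul u v); rewrite size_rcons -cats1 mprod_cat mprod_cons mprod_nil fmulx1.
by split; [rewrite -Eu -Ev | apply: provable_mul].
Qed.

Lemma power_seq (Z : power_fmon S) n s : s \in fexp Z n ->
  exists2 t : seq S, size t = n & {subset t <= Z} /\ s = mprod id t.
Proof.
elim: n s => [|n IHn] s.
  by move/set1P->; exists [::]; rewrite ?mprod_nil.
case/imset2P=> x y Zx /IHn[t <- [tZ ->]] ->.
exists (x :: t); rewrite ?mprod_cons //; split=> //.
by move=> z; rewrite inE => /predU1P[->|/tZ].
Qed.

Lemma liftable_pow (Z : power_fmon S) : liftable Z ->
  exists Y N, liftable Y /\ forall n, N <= n -> fexp Z n \subset Y.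
Proof.
case=> e lift_Z.
(* The bound collects all products of at least |S| elements of Z; their lifts will be provably
   e^omega. *)
exists [set s | `[< exists2 n, #|S| <= n & s \in fexp Z n >]], #|S|; split; last first.
  by move=> n leSn; apply/subsetP=> s Zs; rewrite inE; apply/asboolP; exists n.
exists (osubst w e) => s; rewrite inE => /asboolP[n leSn /power_seq[t size_t [tZ ->]]].
(* Two prefixes have the same value, so the segment [t2] between them fixes the shorter one. *)
have [i [j [lt_ij lejS eq_ij]]] := pigeonhole (fun i => mprod id (take i t)).
have lejt : j <= size t by rewrite size_t (leq_trans lejS).
pose t2 := drop i (take j t).
have take_j : take j t = take i t ++ t2.
  by rewrite -[LHS](cat_take_drop i) take_takel // ltnW.
have [|u1 [E1 e1]] := @liftable_seq Z e (take i t) lift_Z.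
  by move=> x /mem_take/tZ.
have [|u2 [E2 e2]] := @liftable_seq Z e t2 lift_Z.
  by move=> x /mem_drop/mem_take/tZ.
have [|u3 [E3 e3]] := @liftable_seq Z e (drop j t) lift_Z.
  by move=> x /mem_drop/tZ.
(* Replacing the lift of [t2] by its omega-power keeps the value in S and makes the lift provably
   e^i (e^k)^omega e^r. *)
exists (omul (omul u1 (osubst w u2)) u3); split.
  have u12 : val_at u1 ∘ val_at u2 = val_at u1.
    by rewrite E1 E2 -mprod_cat -take_j -eq_ij.
  rewrite -[t in RHS](cat_take_drop j) mprod_cat -E3 -eq_ij -E1.
  exact: (congr1 (fun x => x ∘ val_at u3) (omega_val_absorb u12)).
have t2_gt0 : 0 < size t2 by rewrite size_drop size_takel // subn_gt0.
apply: prov_trans (provable_omega_absorb e (size (take i t)) (size (drop j t)) t2_gt0).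
do 2!apply: provable_mul => //; exact: provable_osubst.
Qed.

Lemma liftable_bounded_powers :
  bounded_powers (fun X Y : power_fmon S => X \subset Y) liftable.
Proof.
split.
- by move=> X; apply: subxx.
- by move=> Y X Z; apply: subset_trans.
- by move=> X X' Y Y' XY XY'; apply: imset2S.
- exists (oone A) => s /set1P->; exists (oone A); split=> //; exact: prefl.
- move=> X Y [e lift_X] [e' lift_Y]; exists (omul e e') => s /imset2P[x y Xx Yy ->].
  have [u [<- ue]] := lift_X x Xx; have [v [<- ve]] := lift_Y y Yy.
  by exists (omul u v); split=> //; apply: provable_mul.
- exact: liftable_pow.
Qed.

Lemma provable_approximation u v : valid_in Sigma (Pid u v) ->
  exists u' v', [/\ prov u' v', val_at u = val_at u' & val_at v = val_at v'].
Proof.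
move=> uv_valid.
have Qphi a : liftable [set phi a].
  exists (ogen a) => s /set1P->; exists (ogen a); split=> //; exact: prefl.
have [U [psi [Z [apU lift_Z subZ]]]] :=
  aperiodic_coverP setT liftable_bounded_powers Qphi.
have eqU : proj1_sig u U psi = proj1_sig v U psi.
  exact: uv_valid (aperiodic_models apU) _ (at_coord_tchom (coord_of psi)).
(* A word for the product of S and U represents z in both at once. *)
have word z : exists x, val_at z = mprod phi x /\ proj1_sig z U psi = mprod psi x.
  have [x Ex] := at_coord_word (T := prod_fmon S U) (fun a => (phi a, psi a)) z.
  have EP : mprod (fun a => (phi a, psi a) : prod_fmon S U) x = (mprod phi x, mprod psi x).
    by elim: x {Ex} => [|a x IHx]; rewrite ?mprod_nil // !mprod_cons IHx.
  rewrite {}EP in Ex; exists x; split.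
    have := proj2_sig z (prod_fmon S U) S fst (conj (fun _ _ => erefl) erefl).
    by move/(_ (fun a => (phi a, psi a))); rewrite Ex => /esym.
  have := proj2_sig z (prod_fmon S U) U snd (conj (fun _ _ => erefl) erefl).
  by move/(_ (fun a => (phi a, psi a))); rewrite Ex => /esym.
(* In the power monoid a word evaluates to the singleton of its value in S, so the cover says that
   this value lies in [Z]. *)
have memZ z : val_at z \in Z (proj1_sig z U psi).
  have [x [-> ->]] := word z.
  have EP : mprod (fun a => [set phi a] : power_fmon S) x = [set mprod phi x].
    by elim: x => [|a x IHx]; rewrite ?mprod_nil // !mprod_cons IHx /= imset2_set1l imset_set1.
  by rewrite -sub1set -EP; apply: subZ => a; rewrite inE.
have [e lift_e] := lift_Z (proj1_sig u U psi).
have [u' [<- u'e]] := lift_e _ (memZ u).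
have := memZ v; rewrite -eqU => /lift_e[v' [<- v'e]].
by exists u', v'; split=> //; apply: prov_trans u'e (provable_sym v'e).
Qed.

End OmegaPower.

(** For w = x^omega (the limit of x^(n!)), the one-element set
    { x^(omega+1) = x^omega } is h-strong within M. *)
Theorem theorem7p3 (w : Omega unit) :
  olim (fun n => opow ox n`!) w ->
  h_strong (fun p => p = Pid (omul w ox) w).
Proof.
move=> w_lim A u v uv_valid; apply: prov_closure => F.
have [[S phi] agrF] := agree_single_coord F.
have [u' [v' [u'v' Eu Ev]]] := provable_approximation w_lim phi uv_valid.
by exists u', v'; split=> //; split; apply: agrF.
Qed.
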